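(* Let $k\in(0,3)$ and $x\in(0,\pi/2)$, and write $M_k(t;q)=\left(1-\frac k3+\frac k3 t^{q}\right)^{1/(kq)}$ for $t\in(0,1)$ ($M_k(t;0)=t^{1/3}$). (i) If $k\in[\frac75,3)$, then $\frac{\sin x}{x}<M_k(\cos x;q)$ holds for all $x\in(0,\pi/2)$ if and only if $q\ge\frac{8}{5(3-k)}$. (ii) If $k\in(p_0,3)$, then $M_k(\cos x;q)<\frac{\sin x}{x}$ holds for all $x\in(0,\pi/2)$ if and only if $q\le\frac{\ln(1-k/3)}{k\ln(2/\pi)}$. (iii) If $k\in(0,\frac{23}{17}]$, then $M_k(\cos x;q)<\frac{\sin x}{x}$ holds for all $x\in(0,\pi/2)$ if and only if $q\le\frac{8}{5(3-k)}$. (iv) If $k\in(0,p_0^* )$, then $\frac{\sin x}{x}<M_k(\cos x;q)$ holds for all $x\in(0,\pi/2)$ if and only if $q\ge\frac{\ln(1-k/3)}{k\ln(2/\pi)}$.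
   Context: $p_0\approx1.42034$ is the unique real $p$ with $\frac{p}{3(1-(2/\pi)^p)}=1$, and $p_0^*\approx1.27754$ is the unique real $p$ with $\frac{p}{3(1-(2/\pi)^p)}=\frac{34}{35}$. *)

(* Defs.v *)
From Stdlib Require Import Reals.
Open Scope R_scope.

(* M_k(t;q) = (1 - k/3 + (k/3) t^q)^(1/(k q)) for q <> 0, and M_k(t;0) = t^(1/3).
   Used for t in (0,1) and k in (0,3), where all bases are positive. *)
Definition Mk (k t q : R) : R :=
  if Req_EM_T q 0 then Rpower t (1/3)
  else Rpower (1 - k/3 + k/3 * Rpower t q) (1 / (k * q)).

Definition pfun (p : R) : R := p / (3 * (1 - Rpower (2/PI) p)).

(* Main.v *)
Require Import Defs.
From Stdlib Require Import Reals QArith Qreals List Classical Lra.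
From Coquelicot Require Import Coquelicot.
Import ListNotations.
Open Scope R_scope.

(* Write [S = sin x / x], [c = cos x], [Q = sin x - x c]. For [q > 0] the sign of
   [M_k(c; q) - S] is that of [G = 1 - S^(kq) - (k/3) (1 - c^q)], and [M_k(c; q)] increases
   with [q]. Both [G] and an auxiliary [L] vanish at [0+], [G'] has the sign of [L], and [L']
   has the sign of [phi = 1 - kq + D + (q - 1) T], where
   [D = (x^2 + x c sin x - 2 sin^2 x) / Q^2] and [T = x sin^2 x / (c Q)].
   Two trigonometric inequalities, [D' > 0] and [35 D' < T'], say that [phi] increases when
   [q >= 1] and decreases when [q <= 34/35]. As [phi -> (3 - k) q - 8/5] at [0+], the value
   [q = 8/(5(3 - k))] gives [phi], [L] and [G] a constant sign, and any other [q] gives them a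
   definite sign near [0]. At [q = ln(1 - k/3) / (k ln(2/pi))] the function [G] also vanishes at
   [pi/2]; then [phi], hence [L], hence [G], changes sign at most once, and a [G] that had
   changed sign would move strictly away from [0] up to [pi/2].
   The two inequalities are linear in the [sin (m x)], [cos (m x)] with polynomial coefficients,
   so they follow from Taylor bounds and interval evaluation of an explicit polynomial. *)

(** * A decision procedure for the positivity of trigonometric polynomials *)
Local Arguments Qred : simpl never.
Local Arguments Qplus : simpl never.
Local Arguments Qmult : simpl never.

(** Coefficients run from the constant term upwards; they are rational so that the final sign test
    is a computation. *)
Fixpoint peval (l : list Q) (x : R) : R :=
  match l with [] => 0 | a :: l' => Q2R a + x * peval l' x end.

Fixpoint padd (l m : list Q) : list Q :=
  match l, m with
  | [], _ => m
  | _, [] => l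
  | a :: l', b :: m' => Qred (a + b) :: padd l' m'
  end.

Definition pscal (a : Q) (l : list Q) : list Q := map (fun b => Qred (a * b)) l.

(** [b] accumulates the power of [a] that belongs to the current coefficient. *)
Fixpoint pdilate (a b : Q) (l : list Q) : list Q :=
  match l with [] => [] | c :: l' => Qred (b * c) :: pdilate a (Qred (a * b)) l' end.

Fixpoint pshift (j : nat) (l : list Q) : list Q :=
  match j with O => l | S j' => 0%Q :: pshift j' l end.

Fixpoint pint_from (n : nat) (l : list Q) : list Q :=
  match l with
  | [] => []
  | a :: l' => Qred (a * (1 # Pos.of_succ_nat n)) :: pint_from (S n) l'
  end.

Definition pint (l : list Q) : list Q := 0%Q :: pint_from 0 l.

Lemma Q2R_red (a : Q) : Q2R (Qred a) = Q2R a.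
Proof. apply Qeq_eqR, Qred_correct. Qed.

Lemma peval_padd (l m : list Q) (x : R) :
  peval (padd l m) x = peval l x + peval m x.
Proof.
  revert m; induction l as [|a l IH]; intros [|b m]; simpl; try lra.
  rewrite Q2R_red, Q2R_plus, IH; ring.
Qed.

Lemma peval_pscal (a : Q) (l : list Q) (x : R) :
  peval (pscal a l) x = Q2R a * peval l x.
Proof.
  induction l as [|b l IH]; simpl; [ring|].
  rewrite Q2R_red, Q2R_mult, IH; ring.
Qed.

Lemma peval_pdilate (a b : Q) (l : list Q) (x : R) :
  peval (pdilate a b l) x = Q2R b * peval l (Q2R a * x).
Proof.
  revert b; induction l as [|c l IH]; intros b; simpl; [ring|].
  rewrite IH, !Q2R_red, !Q2R_mult; ring.
Qed.

Lemma peval_pshift (j : nat) (l : list Q) (x : R) :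
  peval (pshift j l) x = x ^ j * peval l x.
Proof.
  induction j as [|j IH]; simpl; [ring|].
  rewrite IH, RMicromega.Q2R_0; ring.
Qed.

Lemma Q2R_inv_succ (n : nat) : Q2R (1 # Pos.of_succ_nat n) = / INR (S n).
Proof. unfold Q2R; simpl Qnum; rewrite INR_IZR_INZ; simpl; lra. Qed.

(** The factor [y ^ S n] stands for the coefficients already passed, which lets the induction shift
    the degree. *)
Lemma is_derive_pint_from (n : nat) (l : list Q) (x : R) :
  is_derive (fun y => y ^ S n * peval (pint_from n l) y) x (x ^ n * peval l x).
Proof.
  revert n; induction l as [|a l IH]; intros n.
  - apply is_derive_ext with (fun _ => 0); [intros t; simpl; ring|].
    simpl; rewrite Rmult_0_r; apply @is_derive_const.
  - apply is_derive_ext with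
      (fun y => Q2R a * / INR (S n) * y ^ S n + y ^ S (S n) * peval (pint_from (S n) l) y).
    { intros t; simpl peval; rewrite Q2R_red, Q2R_mult, Q2R_inv_succ; simpl; ring. }
    replace (x ^ n * peval (a :: l) x)
      with (Q2R a * / INR (S n) * (INR (S n) * 1 * x ^ n) + x ^ S n * peval l x).
    + apply @is_derive_plus; [|apply IH].
      auto_derive; [trivial|].
      change (match n with O => 1 | S _ => INR n + 1 end) with (INR (S n)); simpl pred; ring.
    + simpl peval. simpl pow. field. apply not_0_INR; discriminate.
Qed.

Lemma is_derive_pint (l : list Q) (x : R) : is_derive (peval (pint l)) x (peval l x).
Proof.
  apply is_derive_ext with (fun y => y ^ 1 * peval (pint_from 0 l) y).
  - intros t; unfold pint; simpl; rewrite RMicromega.Q2R_0; ring.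
  - replace (peval l x) with (x ^ 0 * peval l x) by (simpl; ring).
    apply is_derive_pint_from.
Qed.

Lemma peval_pint_0 (l : list Q) : peval (pint l) 0 = 0.
Proof. unfold pint; simpl; rewrite RMicromega.Q2R_0; ring. Qed.

(** * Taylor bounds for sine and cosine on the nonnegative half-line *)

Lemma le_of_derive_le (f g f' g' : R -> R)
  (Hf : forall x, 0 <= x -> is_derive f x (f' x))
  (Hg : forall x, 0 <= x -> is_derive g x (g' x))
  (H0 : f 0 = g 0) (Hle : forall x, 0 <= x -> f' x <= g' x) (x : R) (Hx : 0 <= x) :
  f x <= g x.
Proof.
  destruct (Req_dec x 0) as [->|Hx0]; [lra|].
  destruct (MVT_cor2 (fun y => g y - f y) (fun y => g' y - f' y) 0 x) as [z [E Hz]]; [lra| |].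
  - intros y Hy; apply is_derive_Reals, @is_derive_minus; [apply Hg | apply Hf]; lra.
  - assert (0 <= (g' z - f' z) * (x - 0))
      by (apply Rmult_le_pos; [specialize (Hle z); lra | lra]).
    lra.
Qed.

(** Since [cos x] is 1 minus the double integral of [cos] from 0, this map turns an upper bound of
    [cos] into a lower one, and conversely. *)
Definition pcos_step (l : list Q) : list Q := padd [1%Q] (pscal (-1) (pint (pint l))).

Lemma is_derive_pcos_step (l : list Q) (x : R) :
  is_derive (peval (pcos_step l)) x (- peval (pint l) x).
Proof.
  apply is_derive_ext with (fun y => 1 - peval (pint (pint l)) y).
  - intros t; unfold pcos_step; rewrite peval_padd, peval_pscal; simpl; unfold Q2R; simpl; field.
  - replace (- peval (pint l) x) with (0 - peval (pint l) x) by ring.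
    apply @is_derive_minus; [apply @is_derive_const | apply is_derive_pint].
Qed.

Lemma peval_pcos_step_0 (l : list Q) : peval (pcos_step l) 0 = 1.
Proof.
  unfold pcos_step; rewrite peval_padd, peval_pscal, peval_pint_0; simpl; unfold Q2R; simpl; field.
Qed.

Definition above (l : list Q) (f : R -> R) : Prop := forall x, 0 <= x -> f x <= peval l x.
Definition below (l : list Q) (f : R -> R) : Prop := forall x, 0 <= x -> peval l x <= f x.

Lemma above_sin (l : list Q) : above l cos -> above (pint l) sin.
Proof.
  intros H x Hx; apply (le_of_derive_le sin (peval (pint l)) cos (peval l)); auto.
  - intros y _; apply is_derive_Reals, derivable_pt_lim_sin.
  - intros y _; apply is_derive_pint.
  - now rewrite sin_0, peval_pint_0.
Qed.

Lemma below_sin (l : list Q) : below l cos -> below (pint l) sin.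
Proof.
  intros H x Hx; apply (le_of_derive_le (peval (pint l)) sin (peval l) cos); auto.
  - intros y _; apply is_derive_pint.
  - intros y _; apply is_derive_Reals, derivable_pt_lim_sin.
  - now rewrite sin_0, peval_pint_0.
Qed.

Lemma below_cos (l : list Q) : above l cos -> below (pcos_step l) cos.
Proof.
  intros H x Hx.
  apply (le_of_derive_le (peval (pcos_step l)) cos
           (fun y => - peval (pint l) y) (fun y => - sin y)); auto.
  - intros y _; apply is_derive_pcos_step.
  - intros y _; apply is_derive_Reals, derivable_pt_lim_cos.
  - now rewrite cos_0, peval_pcos_step_0.
  - intros y Hy; generalize (above_sin l H y Hy); lra.
Qed.

Lemma above_cos (l : list Q) : below l cos -> above (pcos_step l) cos.
Proof.
  intros H x Hx.
  apply (le_of_derive_le cos (peval (pcos_step l))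
           (fun y => - sin y) (fun y => - peval (pint l) y)); auto.
  - intros y _; apply is_derive_Reals, derivable_pt_lim_cos.
  - intros y _; apply is_derive_pcos_step.
  - now rewrite cos_0, peval_pcos_step_0.
  - intros y Hy; generalize (below_sin l H y Hy); lra.
Qed.

(** The Taylor polynomial of degree [4 n]: it ends on a positive term, hence bounds from above. *)
Fixpoint pcos_up (n : nat) : list Q :=
  match n with O => [1%Q] | S m => pcos_step (pcos_step (pcos_up m)) end.

Lemma above_pcos_up (n : nat) : above (pcos_up n) cos.
Proof.
  induction n as [|n IH]; [|simpl; now apply above_cos, below_cos].
  intros x _; simpl; unfold Q2R; simpl; generalize (COS_bound x); lra.
Qed.

(** * Polynomial minorants of trigonometric expressions *)

Inductive trig := One | Sin (m : positive) | Cos (m : positive).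

Definition trigR (t : trig) (x : R) : R :=
  match t with
  | One => 1
  | Sin m => sin (IZR (Zpos m) * x)
  | Cos m => cos (IZR (Zpos m) * x)
  end.

Inductive term := Mono (a : Z) (j : nat) (t : trig).

Definition termR (u : term) (x : R) : R :=
  match u with Mono a j t => IZR a * x ^ j * trigR t x end.

Definition teval (e : list term) (x : R) : R := fold_right (fun u r => termR u x + r) 0 e.

Definition trig_up (n : nat) (t : trig) : list Q :=
  match t with
  | One => [1%Q]
  | Sin m => pdilate (Zpos m # 1) 1 (pint (pcos_up n))
  | Cos m => pdilate (Zpos m # 1) 1 (pcos_up n)
  end.

Definition trig_lo (n : nat) (t : trig) : list Q :=
  match t with
  | One => [1%Q]
  | Sin m => pdilate (Zpos m # 1) 1 (pint (pcos_step (pcos_up n)))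
  | Cos m => pdilate (Zpos m # 1) 1 (pcos_step (pcos_up n))
  end.

Lemma Q2R_inject (z : Z) : Q2R (z # 1) = IZR z.
Proof. unfold Q2R; simpl; field. Qed.

Lemma trig_up_spec (n : nat) (t : trig) : above (trig_up n t) (trigR t).
Proof.
  intros x Hx; assert (Hm : forall m, 0 <= IZR (Zpos m) * x)
    by (intros m; apply Rmult_le_pos; [now apply IZR_le | exact Hx]).
  destruct t as [|m|m]; cbn [trigR trig_up trig_lo].
  - simpl; unfold Q2R; simpl; lra.
  - rewrite peval_pdilate, !Q2R_inject, Rmult_1_l.
    now apply above_sin, Hm; apply above_pcos_up.
  - rewrite peval_pdilate, !Q2R_inject, Rmult_1_l. now apply above_pcos_up.
Qed.

Lemma trig_lo_spec (n : nat) (t : trig) : below (trig_lo n t) (trigR t).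
Proof.
  intros x Hx; assert (Hm : forall m, 0 <= IZR (Zpos m) * x)
    by (intros m; apply Rmult_le_pos; [now apply IZR_le | exact Hx]).
  destruct t as [|m|m]; cbn [trigR trig_up trig_lo].
  - simpl; unfold Q2R; simpl; lra.
  - rewrite peval_pdilate, !Q2R_inject, Rmult_1_l.
    now apply below_sin, Hm; apply below_cos, above_pcos_up.
  - rewrite peval_pdilate, !Q2R_inject, Rmult_1_l.
    now apply below_cos, Hm; apply above_pcos_up.
Qed.

(** As the expression is linear in its atoms, each is bounded separately and no two bounds are ever
    multiplied. *)
Fixpoint minorant (n : nat) (e : list term) : list Q :=
  match e with
  | [] => []
  | Mono a j t :: e' =>
      padd (pscal (a # 1) (pshift j (if (0 <=? a)%Z then trig_lo n t else trig_up n t)))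
           (minorant n e')
  end.

Lemma minorant_spec (n : nat) (e : list term) : below (minorant n e) (teval e).
Proof.
  intros x Hx; induction e as [|[a j t] e IH]; simpl; [lra|].
  rewrite peval_padd, peval_pscal, peval_pshift, Q2R_inject.
  apply Rplus_le_compat; [|exact IH].
  generalize (pow_le x j Hx); intros Hj. rewrite Rmult_assoc.
  destruct (Z.leb_spec 0 a) as [Ha|Ha].
  - apply Rmult_le_compat_l; [now apply IZR_le|].
    now apply Rmult_le_compat_l, trig_lo_spec.
  - apply Rmult_le_compat_neg_l; [now apply IZR_le, Z.lt_le_incl|].
    now apply Rmult_le_compat_l, trig_up_spec.
Qed.

(** * Positivity of a polynomial by interval evaluation *)

Fixpoint strip (l : list Q) : list Q :=
  match l with
  | a :: l' => if Qeq_bool a 0 then strip l' else l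
  | [] => []
  end.

(** The expressions treated below vanish at 0. Dividing by a power of [x] gives a nonzero constant
    term, without which the cell touching 0 could not yield a positive bound. *)
Lemma strip_pos (l : list Q) (x : R) : 0 < x -> 0 < peval (strip l) x -> 0 < peval l x.
Proof.
  intros Hx; induction l as [|a l IH]; simpl; [lra|].
  destruct (Qeq_bool a 0) eqn:E; [|auto].
  intros H; apply Qeq_bool_eq, Qeq_eqR in E; rewrite E, RMicromega.Q2R_0, Rplus_0_l.
  now apply Rmult_lt_0_compat; [|apply IH].
Qed.

(* Interval Horner scheme; the lower end suffices since the variable is nonnegative. *)
Fixpoint horner_lo (a b : Q) (l : list Q) : Q :=
  match l with
  | [] => 0
  | c :: l' => let r := horner_lo a b l' in
               Qred (c + if Qle_bool 0 r then a * r else b * r)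
  end.

Lemma horner_lo_spec (a b : Q) (l : list Q) (x : R) :
  0 <= x -> Q2R a <= x <= Q2R b -> Q2R (horner_lo a b l) <= peval l x.
Proof.
  intros Hx Hab; induction l as [|c l IH]; simpl.
  - rewrite RMicromega.Q2R_0; lra.
  - rewrite Q2R_red, Q2R_plus; apply Rplus_le_compat_l.
    apply Rle_trans with (x * Q2R (horner_lo a b l)); [|now apply Rmult_le_compat_l].
    destruct (Qle_bool 0 (horner_lo a b l)) eqn:E; rewrite Q2R_mult.
    + apply Qle_bool_imp_le, Qle_Rle in E; rewrite RMicromega.Q2R_0 in E.
      now apply Rmult_le_compat_r.
    + assert (E' : (horner_lo a b l <= 0)%Q).
      { destruct (Qlt_le_dec 0 (horner_lo a b l)) as [H|H]; [|exact H].
        apply Qlt_le_weak, Qle_bool_iff in H; congruence. }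
      apply Qle_Rle in E'; rewrite RMicromega.Q2R_0 in E'.
      rewrite (Rmult_comm (Q2R b)), (Rmult_comm x).
      apply Rmult_le_compat_neg_l; [exact E' | apply Hab].
Qed.

Fixpoint pos_cells (a h : Q) (N : nat) (l : list Q) : bool :=
  match N with
  | O => true
  | S M => negb (Qle_bool (horner_lo a (Qred (a + h)) l) 0)
           && pos_cells (Qred (a + h)) h M l
  end.

Lemma pos_cells_spec (a h : Q) (N : nat) (l : list Q) (x : R) :
  pos_cells a h N l = true -> 0 <= x -> 
  Q2R a < x <= Q2R a + INR N * Q2R h -> 0 < peval l x.
Proof.
  revert a; induction N as [|N IH]; intros a H Hx Hax; [simpl in Hax; lra|].
  simpl in H; apply andb_prop in H; destruct H as [H1 H2].
  destruct (Rle_lt_dec x (Q2R (Qred (a + h)))) as [Hl|Hl].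
  - apply Rlt_le_trans with (Q2R (horner_lo a (Qred (a + h)) l));
      [|apply horner_lo_spec; lra].
    rewrite <- RMicromega.Q2R_0; apply Qlt_Rlt.
    destruct (Qlt_le_dec 0 (horner_lo a (Qred (a + h)) l)) as [L|L]; [exact L|].
    apply Qle_bool_iff in L; rewrite L in H1; discriminate.
  - apply (IH _ H2 Hx); rewrite S_INR in Hax.
    rewrite Q2R_red, Q2R_plus in *; lra.
Qed.

(** The [N] cells have width [8/(5 N)] and fill [[0, 8/5]], which contains [(0, PI/2)] by
    [PI2_lt]. *)
Lemma teval_pos (n N : nat) (e : list term) (x : R) :
  pos_cells 0 (8 # (5 * Pos.of_nat N)) N (strip (minorant n e)) = true ->
  N <> O -> 0 < x <= 8/5 -> 0 < teval e x.
Proof.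
  intros H HN Hx.
  apply Rlt_le_trans with (peval (minorant n e) x); [|apply minorant_spec; lra].
  apply strip_pos; [lra|]; apply (pos_cells_spec _ _ _ _ _ H); [lra|].
  assert (HN' : INR N <> 0) by now apply not_0_INR.
  replace (Q2R (8 # (5 * Pos.of_nat N))) with (8 / (5 * INR N)).
  - rewrite RMicromega.Q2R_0.
    replace (0 + INR N * (8 / (5 * INR N))) with (8/5) by (field; exact HN'). lra.
  - unfold Q2R; cbn [Qnum Qden].
    rewrite Pos2Z.inj_mul, mult_IZR, <- (Znat.positive_nat_Z (Pos.of_nat N)), Nat2Pos.id,
      <- INR_IZR_INZ; auto.
Qed.

(** * The trigonometric inequalities *)

Lemma sin_2 (x : R) : sin (2 * x) = 2 * sin x * cos x.
Proof. apply sin_2a. Qed.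

(** As a rewrite rule of [ring], it leaves [cos x] in degree at most one, which decides identities
    between trigonometric polynomials. *)
Lemma pow_cos (x : R) : cos x ^ 2 = 1 - sin x ^ 2.
Proof. generalize (sin2_cos2 x); unfold Rsqr; lra. Qed.

Lemma cos_2 (x : R) : cos (2 * x) = 1 - 2 * sin x ^ 2.
Proof. rewrite cos_2a_sin; ring. Qed.

Lemma sin_3 (x : R) : sin (3 * x) = 3 * sin x - 4 * sin x ^ 3.
Proof.
  replace (3 * x) with (2 * x + x) by ring.
  rewrite sin_plus, sin_2, cos_2; ring [(pow_cos x)].
Qed.

Lemma cos_3 (x : R) : cos (3 * x) = cos x - 4 * sin x ^ 2 * cos x.
Proof.
  replace (3 * x) with (2 * x + x) by ring.
  rewrite cos_plus, sin_2, cos_2; ring [(pow_cos x)].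
Qed.

Lemma sin_5 (x : R) : sin (5 * x) = 16 * sin x ^ 5 - 20 * sin x ^ 3 + 5 * sin x.
Proof.
  replace (5 * x) with (3 * x + 2 * x) by ring.
  rewrite sin_plus, sin_2, cos_2, sin_3, cos_3; ring [(pow_cos x)].
Qed.

Lemma cos_5 (x : R) : cos (5 * x) = cos x * (16 * sin x ^ 4 - 12 * sin x ^ 2 + 1).
Proof.
  replace (5 * x) with (3 * x + 2 * x) by ring.
  rewrite cos_plus, sin_2, cos_2, sin_3, cos_3; ring [(pow_cos x)].
Qed.

(** [n] sets the Taylor degree and [N] the number of cells. Multiple angles are expanded into powers
    of [sin x] and [cos x] only after positivity is known. *)
Ltac by_linearisation e n N :=
  lazymatch goal with
  | Hx : 0 < ?x <= 8/5 |- _ =>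
    let H := fresh in
    assert (H : 0 < teval e x)
      by (apply (teval_pos n N); [vm_compute; reflexivity | discriminate | exact Hx]);
    cbn [teval fold_right termR trigR] in H;
    rewrite ?sin_5, ?cos_5, ?sin_3, ?cos_3, ?sin_2, ?cos_2, ?Rmult_1_l in H
  end.

(** The quotient of the right side by [x^3] tends to [1/3] at 0 and still exceeds [1/4] at [8/5].
    This is the lower bound for the denominators of [Dfun] and [Tfun]. *)
Lemma sin_sub_mul_cos_gt (x : R) : 0 < x <= 8/5 -> x ^ 3 / 4 < sin x - x * cos x.
Proof.
  intros Hx.
  by_linearisation [Mono 4 0 (Sin 1); Mono (-4) 1 (Cos 1); Mono (-1) 3 One] 6%nat 20%nat.
  lra.
Qed.

(** [Dnum] and [Tnum] are, up to positive factors, the derivatives of [Dfun] and [Tfun]. *)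
Definition Dnum (x : R) : R :=
  - 2 * x ^ 3 * sin x - 3 * x ^ 2 * cos x + 6 * x * sin x - x * sin x ^ 3
  - 3 * sin x ^ 2 * cos x.

Definition Tnum (x : R) : R := sin x ^ 2 * cos x + x * sin x - 2 * x ^ 2 * cos x.

(* The list is [4 * Dnum x], linearised by multiple-angle formulas. *)
Lemma Dnum_pos (x : R) : 0 < x <= 8/5 -> 0 < Dnum x.
Proof.
  intros Hx; unfold Dnum.
  by_linearisation
    [Mono (-8) 3 (Sin 1); Mono (-12) 2 (Cos 1); Mono 21 1 (Sin 1); Mono 1 1 (Sin 3);
     Mono (-3) 0 (Cos 1); Mono 3 0 (Cos 3)] 8%nat 20%nat.
  lra.
Qed.

(* The list is 16 times the difference of the two sides. *)
Lemma Dnum_lt_Tnum (x : R) : 0 < x <= 8/5 ->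
  35 * cos x ^ 2 * Dnum x < (sin x - x * cos x) * sin x * Tnum x.
Proof.
  intros Hx; unfold Dnum, Tnum.
  by_linearisation
    [Mono 212 0 (Cos 1); Mono (-108) 0 (Cos 3); Mono (-104) 0 (Cos 5); Mono (-760) 1 (Sin 1);
     Mono (-810) 1 (Sin 3); Mono (-34) 1 (Sin 5); Mono 1248 2 (Cos 1); Mono 432 2 (Cos 3);
     Mono 288 3 (Sin 1); Mono 288 3 (Sin 3)] 10%nat 40%nat.
  match type of H with 0 < ?a => match goal with |- ?l < ?r =>
    replace a with (16 * (r - l)) in H by ring [(pow_cos x)] end end.
  lra.
Qed.

(** The square of [sin x - x cos x] has order [x^6], so an error of order [x^8] gives
    [Dfun = 2/5 + O(x^2)]. Each list is twice the difference to be shown positive. *)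
Lemma numD_bound (x : R) : 0 < x <= 8/5 ->
  Rabs (5 * (x ^ 2 + x * sin x * cos x - 2 * sin x ^ 2) - 2 * (sin x - x * cos x) ^ 2) < x ^ 8.
Proof.
  intros Hx; apply Rabs_def1.
  - by_linearisation
      [Mono 2 8 One; Mono (-8) 2 One; Mono (-9) 1 (Sin 2); Mono 12 0 One; Mono (-12) 0 (Cos 2);
       Mono 2 2 (Cos 2)] 8%nat 20%nat.
    ring_simplify [(pow_cos x)] in H; ring_simplify [(pow_cos x)]; lra.
  - by_linearisation
      [Mono 2 8 One; Mono 8 2 One; Mono 9 1 (Sin 2); Mono (-12) 0 One; Mono 12 0 (Cos 2);
       Mono (-2) 2 (Cos 2)] 8%nat 20%nat.
    ring_simplify [(pow_cos x)] in H; ring_simplify [(pow_cos x)]; lra.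
Qed.

(** An error of order [x^5] against a denominator of order [x^3] gives [Tfun = 3 + O(x^2)]. *)
Lemma numT_bound (x : R) : 0 < x <= 8/5 ->
  Rabs (x * sin x ^ 2 - 3 * cos x * (sin x - x * cos x)) < x ^ 5.
Proof.
  intros Hx; apply Rabs_def1.
  - by_linearisation
      [Mono 2 5 One; Mono (-4) 1 One; Mono (-2) 1 (Cos 2); Mono 3 0 (Sin 2)] 8%nat 20%nat.
    ring_simplify [(pow_cos x)] in H; ring_simplify [(pow_cos x)]; lra.
  - by_linearisation
      [Mono 2 5 One; Mono 4 1 One; Mono 2 1 (Cos 2); Mono (-3) 0 (Sin 2)] 8%nat 20%nat.
    ring_simplify [(pow_cos x)] in H; ring_simplify [(pow_cos x)]; lra.
Qed.

(** Otherwise [cos (8/5)] would be nonnegative, but its Taylor upper bound of degree 4 is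
    negative. *)
Lemma PI2_lt : PI / 2 < 8 / 5.
Proof.
  apply Rnot_le_lt; intros H.
  assert (0 <= cos (8/5)) by (apply cos_ge_0; generalize PI2_3_2; lra).
  generalize (above_pcos_up 1 (8/5) ltac:(lra)).
  unfold pcos_up, pcos_step, pint; simpl; unfold Q2R; simpl. lra.
Qed.

(** * Monotonicity of the auxiliary quotients *)

Definition Dfun (x : R) : R :=
  (x ^ 2 + x * sin x * cos x - 2 * sin x ^ 2) / (sin x - x * cos x) ^ 2.

Definition Tfun (x : R) : R := x * sin x ^ 2 / (cos x * (sin x - x * cos x)).

Definition Dfun' (x : R) : R := Dnum x / (sin x - x * cos x) ^ 3.
Definition Tfun' (x : R) : R :=
  sin x * Tnum x / (cos x ^ 2 * (sin x - x * cos x) ^ 2).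

Lemma trig_signs (x : R) : 0 < x < PI / 2 ->
  0 < sin x /\ 0 < cos x /\ 0 < sin x - x * cos x.
Proof.
  intros Hx; generalize PI2_lt; intros HPI; repeat split.
  - apply sin_gt_0; lra.
  - apply cos_gt_0; lra.
  - generalize (sin_sub_mul_cos_gt x ltac:(lra)) (pow_lt x 3 ltac:(lra)); lra.
Qed.

Lemma is_derive_Dfun (x : R) : 0 < x < PI / 2 -> is_derive Dfun x (Dfun' x).
Proof.
  intros Hx; destruct (trig_signs x Hx) as (Hs & Hc & HQ).
  unfold Dfun, Dfun', Dnum; auto_derive.
  - apply Rgt_not_eq; simpl; now repeat apply Rmult_lt_0_compat; try lra.
  - field_simplify_eq; [|lra]. ring [(pow_cos x)].
Qed.

Lemma is_derive_Tfun (x : R) : 0 < x < PI / 2 -> is_derive Tfun x (Tfun' x).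
Proof.
  intros Hx; destruct (trig_signs x Hx) as (Hs & Hc & HQ).
  unfold Tfun, Tfun', Tnum; auto_derive.
  - apply Rgt_not_eq; simpl; now repeat apply Rmult_lt_0_compat; try lra.
  - field_simplify_eq; [|lra]. ring [(pow_cos x)].
Qed.

Lemma Dfun'_pos (x : R) : 0 < x < PI / 2 -> 0 < Dfun' x.
Proof.
  intros Hx; destruct (trig_signs x Hx) as (Hs & Hc & HQ); generalize PI2_lt; intros HPI.
  apply Rdiv_lt_0_compat; [|now apply pow_lt].
  apply Dnum_pos; lra.
Qed.

Lemma Dfun'_lt (x : R) : 0 < x < PI / 2 -> 35 * Dfun' x < Tfun' x.
Proof.
  intros Hx; destruct (trig_signs x Hx) as (Hs & Hc & HQ); generalize PI2_lt; intros HPI.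
  generalize (Dnum_lt_Tnum x ltac:(lra)); intros H.
  apply Rlt_0_minus; unfold Dfun', Tfun'.
  replace (_ - _) with
    (((sin x - x * cos x) * sin x * Tnum x - 35 * cos x ^ 2 * Dnum x)
     / (cos x ^ 2 * (sin x - x * cos x) ^ 3)) by (field; lra).
  apply Rdiv_lt_0_compat; [lra|].
  now apply Rmult_lt_0_compat; apply pow_lt.
Qed.

Lemma Dfun_near (x : R) : 0 < x < PI / 2 -> Rabs (Dfun x - 2 / 5) <= 4 * x ^ 2.
Proof.
  intros Hx; destruct (trig_signs x Hx) as (Hs & Hc & HQ); generalize PI2_lt; intros HPI.
  generalize (numD_bound x ltac:(lra)) (sin_sub_mul_cos_gt x ltac:(lra)).
  set (Q := sin x - x * cos x) in *; intros H1 H2.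
  assert (Hx3 := pow_lt x 3 ltac:(lra)).
  unfold Dfun; fold Q.
  set (N := x ^ 2 + x * sin x * cos x - 2 * sin x ^ 2) in *.
  replace (N / Q ^ 2 - 2 / 5) with ((5 * N - 2 * Q ^ 2) * / (5 * Q ^ 2)) by (field; lra).
  assert (HQ2 : 0 < 5 * Q ^ 2) by (generalize (pow_lt Q 2 HQ); lra).
  rewrite Rabs_mult, (Rabs_pos_eq (/ _)) by (left; now apply Rinv_0_lt_compat).
  apply Rmult_le_reg_r with (5 * Q ^ 2); [exact HQ2|].
  rewrite Rmult_assoc, Rinv_l, Rmult_1_r by lra.
  (* Hence [4 x^2 * 5 Q^2 >= (5/4) x^8], more than the bound [x^8] on the numerator. *)
  assert ((x ^ 3 / 4) ^ 2 <= Q ^ 2) by (apply pow_incr; lra).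
  assert (0 < x ^ 2) by (apply pow_lt; lra).
  nra.
Qed.

Lemma Tfun_near (x : R) : 0 < x < PI / 2 -> Rabs (Tfun x - 3) <= 4 * x ^ 2 / cos x.
Proof.
  intros Hx; destruct (trig_signs x Hx) as (Hs & Hc & HQ); generalize PI2_lt; intros HPI.
  generalize (numT_bound x ltac:(lra)) (sin_sub_mul_cos_gt x ltac:(lra)).
  unfold Tfun.
  set (Q := sin x - x * cos x) in *; intros H1 H2.
  replace (_ / _ - 3) with ((x * sin x ^ 2 - 3 * cos x * Q) * / (cos x * Q)) by (field; lra).
  assert (HcQ : 0 < cos x * Q) by now apply Rmult_lt_0_compat.
  rewrite Rabs_mult, (Rabs_pos_eq (/ _)) by (left; now apply Rinv_0_lt_compat).
  apply Rmult_le_reg_r with (cos x * Q); [exact HcQ|].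
  rewrite Rmult_assoc, Rinv_l, Rmult_1_r by lra.
  (* Here [4 x^2 Q > x^5], because [Q > x^3 / 4]. *)
  replace (4 * x ^ 2 / cos x * (cos x * Q)) with (4 * x ^ 2 * Q) by (field; lra).
  assert (0 < x ^ 2) by (apply pow_lt; lra).
  nra.
Qed.

(** * Sign propagation from a derivative *)

Definition lim0 (f : R -> R) (l : R) : Prop := filterlim f (at_right 0) (locally l).

Lemma lim0_iff (f : R -> R) (l : R) :
  lim0 f l <->
  forall eps, 0 < eps -> exists d, 0 < d /\ forall x, 0 < x < d -> Rabs (f x - l) < eps.
Proof.
  unfold lim0; split.
  - intros H eps Heps.
    destruct (proj1 (filterlim_locally f l) H (mkposreal eps Heps)) as [d Hd].
    exists d; split; [apply cond_pos|]; intros x Hx; apply Hd; [|lra].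
    change (Rabs (x - 0) < d); rewrite Rminus_0_r, Rabs_pos_eq; lra.
  - intros H; apply filterlim_locally; intros eps.
    destruct (H eps (cond_pos eps)) as (d & Hd & Hx).
    exists (mkposreal d Hd); intros y Hy Hy0; apply Hx; split; [exact Hy0|].
    change (Rabs (y - 0) < d) in Hy; rewrite Rminus_0_r, Rabs_pos_eq in Hy; lra.
Qed.

Lemma lim0_ext (f g : R -> R) (l m : R) :
  (forall x, f x = g x) -> l = m -> lim0 f l -> lim0 g m.
Proof. intros Hfg <-; now apply filterlim_ext. Qed.

Lemma lim0_comp (f g : R -> R) (l : R) :
  lim0 f l -> continuous g l -> lim0 (fun x => g (f x)) (g l).
Proof. intros Hf Hg; exact (filterlim_comp _ _ _ f g _ _ _ Hf Hg). Qed.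

Lemma lim0_plus (f g : R -> R) (l m : R) :
  lim0 f l -> lim0 g m -> lim0 (fun x => f x + g x) (l + m).
Proof.
  intros Hf Hg; apply (filterlim_comp_2 (F := at_right 0) f g Rplus Hf Hg).
  apply (filterlim_plus l m).
Qed.

Lemma lim0_scal (a : R) (f : R -> R) (l : R) : lim0 f l -> lim0 (fun x => a * f x) (a * l).
Proof.
  intros Hf; apply (lim0_comp f (fun y => a * y)); [exact Hf|].
  apply (ex_derive_continuous (fun y : R => a * y)); auto_derive; trivial.
Qed.

Lemma lim0_ln (f : R -> R) : lim0 f 1 -> lim0 (fun x => ln (f x)) 0.
Proof.
  intros Hf; rewrite <- ln_1; apply (lim0_comp f ln); [exact Hf|]. 
  apply (ex_derive_continuous ln); auto_derive; lra.
Qed.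

Lemma lim0_exp (f : R -> R) : lim0 f 0 -> lim0 (fun x => exp (f x)) 1.
Proof.
  intros Hf; rewrite <- exp_0; apply (lim0_comp f exp); [exact Hf|]. 
  apply (ex_derive_continuous exp); auto_derive; trivial.
Qed.

Lemma lim0_of_sq (f : R -> R) (l C : R) (HC : 0 <= C) :
  (forall x, 0 < x < 1 -> Rabs (f x - l) <= C * x ^ 2) -> lim0 f l.
Proof.
  intros H; apply lim0_iff; intros eps Heps.
  assert (Hd : 0 < eps / (C + 1)) by (apply Rdiv_lt_0_compat; lra).
  (* [C + 1] avoids a division by 0, and [x < 1] bounds [C x^2] by [C x]. *)
  exists (Rmin 1 (eps / (C + 1))); split; [apply Rmin_pos; lra|].
  intros x [Hx1 Hx2].
  assert (Hx : x < 1) by (eapply Rlt_le_trans; [exact Hx2 | apply Rmin_l]).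
  assert (Hx' : x < eps / (C + 1)) by (eapply Rlt_le_trans; [exact Hx2 | apply Rmin_r]).
  apply Rle_lt_trans with (C * x ^ 2); [apply H; lra|].
  assert (x * (C + 1) < eps).
  { apply Rmult_lt_reg_r with (/ (C + 1)); [apply Rinv_0_lt_compat; lra|].
    rewrite Rmult_assoc, Rinv_r by lra. lra. }
  nra.
Qed.

Lemma lim0_Dfun : lim0 Dfun (2 / 5).
Proof.
  apply lim0_of_sq with 4; [lra|].
  intros x Hx; apply Dfun_near; generalize PI2_3_2; lra.
Qed.

Lemma lim0_cos : lim0 cos 1.
Proof.
  rewrite <- cos_0; intros P HP; destruct (continuous_cos 0 P HP) as [d Hd].
  exists d; intros y Hy _; now apply Hd.
Qed.

Lemma lim0_Tfun : lim0 Tfun 3.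
Proof.
  apply lim0_of_sq with 8; [lra|].
  intros x Hx; generalize PI2_3_2; intros HPI.
  apply Rle_trans with (1 := Tfun_near x ltac:(lra)).
  (* From [cos x >= 1 - x^2/2] on [(0, 1)]; it turns the bound [4 x^2 / cos x] into [8 x^2]. *)
  assert (Hc : / 2 < cos x).
  { generalize (COS_bound x) (pre_cos_bound x 0); intros _ H.
    destruct H as [H _]; [lra|lra|].
    unfold cos_approx, cos_term in H; simpl in H. nra. }
  apply Rmult_le_reg_r with (cos x); [lra|].
  unfold Rdiv; rewrite Rmult_assoc, Rinv_l, Rmult_1_r by lra.
  assert (0 < x ^ 2) by (apply pow_lt; lra). nra.
Qed.

Lemma lim0_sinc : lim0 (fun x => sin x / x) 1.
Proof.
  intros P HP; destruct (is_lim_sinc_0 P HP) as [d Hd].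
  exists d; intros y Hy Hy0; apply Hd; [exact Hy | lra].
Qed.

(** At most one sign change, from negative to positive, and no lingering at 0. *)
Definition single_up (b : R) (f : R -> R) : Prop :=
  forall x y, 0 < x < y -> y < b -> 0 <= f x -> 0 < f y.

Definition pos_on (b : R) (f : R -> R) : Prop := forall x, 0 < x < b -> 0 < f x.

Lemma increment_pos (b : R) (f f' : R -> R) (x y : R)
  (Hd : forall x, 0 < x < b -> is_derive f x (f' x)) :
  0 < x < y -> y < b -> (forall z, x < z < y -> 0 < f' z) -> f x < f y.
Proof.
  intros Hxy Hy Hpos.
  destruct (MVT_cor2 f f' x y) as (z & E & Hz); [lra| |].
  - intros z Hz; apply is_derive_Reals, Hd; lra.
  - assert (0 < f' z * (y - x)) by (apply Rmult_lt_0_compat; [now apply Hpos | lra]).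
    lra.
Qed.

(** [f] is strictly increasing. If [f x <= 0], then [f (x / 2) < 0] and all values further left are
    lower still, against the limit 0. *)
Lemma pos_on_of_derive (b : R) (f f' : R -> R)
  (Hd : forall x, 0 < x < b -> is_derive f x (f' x)) (H0 : lim0 f 0) :
  pos_on b f' -> pos_on b f.
Proof.
  intros Hpos x Hx.
  assert (Hh : forall y z, 0 < y < z -> z < b -> f y < f z).
  { intros y z Hyz Hz; apply (increment_pos b f f'); auto.
    intros w Hw; apply Hpos; lra. }
  apply Rnot_le_lt; intros Hle.
  assert (Hx2 := Hh (x / 2) x ltac:(lra) ltac:(lra)).
  destruct (proj1 (lim0_iff f 0) H0 (- f (x / 2)) ltac:(lra)) as (d & Hd0 & Hd1).
  (* A point left of [x / 2] and within [d] of 0. *)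
  set (y := Rmin (x / 4) (d / 2)).
  assert (Hy : 0 < y) by (apply Rmin_pos; lra).
  assert (Hyx : y <= x / 4) by apply Rmin_l.
  assert (Hyd : y <= d / 2) by apply Rmin_r.
  specialize (Hd1 y ltac:(lra)); specialize (Hh y (x / 2) ltac:(lra) ltac:(lra)).
  rewrite Rminus_0_r in Hd1; apply Rabs_def2 in Hd1; lra.
Qed.

(** If [0 <= f' z] for some [z < x], then [f' > 0] from there on and [f] increases past [x].
    Otherwise [f' < 0] on all of [(0, x)], and [f], falling from its limit 0, would be negative at
    [x]. *)
Lemma increasing_after (b : R) (f f' : R -> R)
  (Hd : forall x, 0 < x < b -> is_derive f x (f' x)) (H0 : lim0 f 0) :
  single_up b f' -> forall x y, 0 < x < y -> y < b -> 0 <= f x -> f x < f y.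
Proof.
  intros Hup x y Hxy Hy Hfx.
  destruct (classic (exists z, 0 < z < x /\ 0 <= f' z)) as [(z & Hz & Hfz)|Hno].
  - apply (increment_pos b f f'); auto.
    intros w Hw; apply (Hup z w); lra.
  - exfalso.
    assert (Hneg : pos_on x (fun t => - f t)).
    { apply (pos_on_of_derive x _ (fun t => - f' t)).
      - intros t Ht; apply @is_derive_opp, Hd; lra.
      - apply (lim0_ext (fun t => -1 * f t) _ (-1 * 0)); [intros; ring | ring |].
        now apply lim0_scal.
      - intros z Hz; apply Rnot_le_lt; intros Hle; apply Hno; exists z; lra. }
    (* [Hneg] covers only points left of [x]; one more mean value step from [x / 2] reaches [x]
       itself. *)
    assert (f x < f (x / 2)).
    { destruct (MVT_cor2 f f' (x / 2) x) as (z & E & Hz); [lra| |].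
      - intros z Hz; apply is_derive_Reals, Hd; lra.
      - assert (f' z < 0) by (apply Rnot_le_lt; intros Hle; apply Hno; exists z; lra).
        assert (f' z * (x - x / 2) < 0) by (apply Rmult_neg_pos; lra).
        lra. }
    specialize (Hneg (x / 2) ltac:(lra)); simpl in Hneg; lra.
Qed.

Lemma single_up_of_derive (b : R) (f f' : R -> R)
  (Hd : forall x, 0 < x < b -> is_derive f x (f' x)) (H0 : lim0 f 0) :
  single_up b f' -> single_up b f.
Proof.
  intros Hup x y Hxy Hy Hfx; apply Rle_lt_trans with (1 := Hfx).
  now apply (increasing_after b f f').
Qed.

Lemma single_up_sign (b : R) (f g : R -> R) :
  (forall x, 0 < x < b -> 0 <= g x -> 0 <= f x) ->
  (forall x, 0 < x < b -> 0 < f x -> 0 < g x) ->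
  single_up b f -> single_up b g.
Proof.
  intros H1 H2 Hf x y Hxy Hy Hg; apply H2; [lra|].
  apply (Hf x y); auto; apply H1; auto; lra.
Qed.

Lemma single_up_of_derive_pos (b : R) (f f' : R -> R)
  (Hd : forall x, 0 < x < b -> is_derive f x (f' x)) :
  pos_on b f' -> single_up b f.
Proof.
  intros Hpos x y Hxy Hy Hfx; apply Rle_lt_trans with (1 := Hfx).
  apply (increment_pos b f f'); auto; intros z Hz; apply Hpos; lra.
Qed.

(** * The functions phi, L and G *)

Definition phi (k q x : R) : R := 1 - k * q + Dfun x + (q - 1) * Tfun x.

(** For [k, q > 0], [exp (Lfun k q x)] is the ratio of the positive to the negative term in the
    derivative of [Gfun k q]. *)
Definition Lfun (k q x : R) : R :=
  k * q * ln (sin x / x) - q * ln (cos x) - ln (Tfun x / 3).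

Definition Gfun (k q x : R) : R :=
  1 - Rpower (sin x / x) (k * q) - k / 3 * (1 - Rpower (cos x) q).

(** Minus the logarithmic derivative of [sin x / x]. It is the positive factor between [phi] and the
    derivative of [Lfun], as [L_weight] is between [exp Lfun - 1] and the derivative of [Gfun]. *)
Definition phi_weight (x : R) : R := (sin x - x * cos x) / (x * sin x).

Definition L_weight (k q x : R) : R := k * q / 3 * Rpower (cos x) q * sin x / cos x.

Lemma Tfun_pos (x : R) : 0 < x < PI / 2 -> 0 < Tfun x.
Proof.
  intros Hx; destruct (trig_signs x Hx) as (Hs & Hc & HQ).
  unfold Tfun; apply Rdiv_lt_0_compat; [|now apply Rmult_lt_0_compat].
  apply Rmult_lt_0_compat; [lra | now apply pow_lt].
Qed.

Lemma is_derive_Lfun (k q x : R) : 0 < x < PI / 2 ->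
  is_derive (Lfun k q) x (phi_weight x * phi k q x).
Proof.
  intros Hx; destruct (trig_signs x Hx) as (Hs & Hc & HQ).
  assert (HT := Tfun_pos x Hx).
  unfold Lfun, phi, phi_weight, Dfun, Tfun in *; auto_derive.
  - repeat split; try lra.
    + exact (Rdiv_lt_0_compat _ x Hs (proj1 Hx)).
    + apply Rgt_not_eq; exact (Rmult_lt_0_compat _ _ Hc HQ).
    + exact (Rdiv_lt_0_compat _ 3 HT ltac:(lra)).
  - field_simplify_eq; [|repeat split; lra]. ring [(pow_cos x)].
Qed.

Lemma is_derive_Gfun (k q x : R) : 0 < x < PI / 2 ->
  is_derive (Gfun k q) x (L_weight k q x * (exp (Lfun k q x) - 1)).
Proof.
  intros Hx; destruct (trig_signs x Hx) as (Hs & Hc & HQ).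
  assert (HT := Tfun_pos x Hx).
  assert (HS : 0 < sin x / x) by (apply Rdiv_lt_0_compat; lra).
  replace (L_weight k q x * (exp (Lfun k q x) - 1)) with
    (k * q * (Rpower (sin x / x) (k * q) * ((sin x - x * cos x) / (x * sin x))
              - / 3 * Rpower (cos x) q * sin x / cos x)).
  - unfold Gfun, Rpower; auto_derive.
    + repeat split; try lra; exact HS.
    + unfold Rdiv; generalize (exp (k * q * ln (sin x * / x))) (exp (q * ln (cos x))).
      intros u v; field; repeat split; lra.
  - assert (E : exp (Lfun k q x) =
                Rpower (sin x / x) (k * q) * / Rpower (cos x) q * / (Tfun x / 3)).
    { unfold Lfun, Rminus; rewrite !exp_plus, !exp_Ropp, exp_ln by lra; reflexivity. }
    rewrite E; unfold L_weight, Tfun.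
    assert (Rpower (cos x) q <> 0) by apply Rgt_not_eq, exp_pos.
    field; repeat split; lra.
Qed.

Lemma lim0_Lfun (k q : R) : lim0 (Lfun k q) 0.
Proof.
  apply (lim0_ext
    (fun x => k * q * ln (sin x / x) + (- q * ln (cos x) + -1 * ln (/ 3 * Tfun x)))
    _ (k * q * 0 + (- q * 0 + -1 * 0))).
  - intros x; unfold Lfun, Rdiv; rewrite (Rmult_comm (Tfun x)); ring.
  - ring.
  - apply lim0_plus; [|apply lim0_plus]; apply lim0_scal, lim0_ln.
    + exact lim0_sinc.
    + exact lim0_cos.
    + replace 1 with (/ 3 * 3) by field; apply lim0_scal, lim0_Tfun.
Qed.

Lemma lim0_Gfun (k q : R) : lim0 (Gfun k q) 0.
Proof.
  apply (lim0_ext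
    (fun x => (-1 * exp (k * q * ln (sin x / x)) + k / 3 * exp (q * ln (cos x))) +
              (1 - k / 3)) _ ((-1 * 1 + k / 3 * 1) + (1 - k / 3))).
  - intros x; unfold Gfun, Rpower; ring.
  - field.
  - apply lim0_plus; [|apply filterlim_const].
    apply lim0_plus; apply lim0_scal, lim0_exp.
    + rewrite <- (Rmult_0_r (k * q)); apply lim0_scal, lim0_ln, lim0_sinc.
    + rewrite <- (Rmult_0_r q); apply lim0_scal, lim0_ln, lim0_cos.
Qed.

Lemma Tfun'_pos (x : R) : 0 < x < PI / 2 -> 0 < Tfun' x.
Proof. intros Hx; generalize (Dfun'_pos x Hx) (Dfun'_lt x Hx); lra. Qed.

Lemma is_derive_phi (k q x : R) : 0 < x < PI / 2 ->
  is_derive (phi k q) x (Dfun' x + (q - 1) * Tfun' x).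
Proof.
  intros Hx; unfold phi.
  replace (Dfun' x + (q - 1) * Tfun' x) with (0 + Dfun' x + (q - 1) * Tfun' x) by ring.
  apply @is_derive_plus; [apply @is_derive_plus; [apply @is_derive_const|]|].
  - now apply is_derive_Dfun.
  - now apply is_derive_scal, is_derive_Tfun.
Qed.

Lemma lim0_phi (k q : R) : lim0 (phi k q) ((3 - k) * q - 8 / 5).
Proof.
  apply (lim0_ext (fun x => 1 - k * q + (Dfun x + (q - 1) * Tfun x)) _
           (1 - k * q + (2 / 5 + (q - 1) * 3))).
  - intros x; unfold phi; ring.
  - field.
  - apply lim0_plus; [apply filterlim_const|].
    apply lim0_plus; [exact lim0_Dfun | apply lim0_scal, lim0_Tfun].
Qed.

Lemma lim0_pos (f : R -> R) (l : R) : lim0 f l -> 0 < l -> exists d, 0 < d /\ pos_on d f.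
Proof.
  intros Hf Hl; destruct (proj1 (lim0_iff f l) Hf l Hl) as (d & Hd & H).
  exists d; split; [exact Hd|]; intros x Hx.
  specialize (H x Hx); apply Rabs_def2 in H; lra.
Qed.

(** The factor [s] lets one argument serve an inequality and its reverse. *)
Definition is_sign (s : R) : Prop := s = 1 \/ s = -1.

Lemma sign_exp_sub_1 (s y : R) : is_sign s ->
  (0 <= s * (exp y - 1) -> 0 <= s * y) /\ (0 < s * y -> 0 < s * (exp y - 1)).
Proof.
  rewrite <- exp_0; intros [-> | ->]; split; intros H.
  - apply Rnot_lt_le; intros L; generalize (exp_increasing y 0 ltac:(lra)); lra.
  - generalize (exp_increasing 0 y ltac:(lra)); lra.
  - apply Rnot_lt_le; intros L; generalize (exp_increasing 0 y ltac:(lra)); lra.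
  - generalize (exp_increasing y 0 ltac:(lra)); lra.
Qed.

Lemma phi_weight_pos (x : R) : 0 < x < PI / 2 -> 0 < phi_weight x.
Proof.
  intros Hx; destruct (trig_signs x Hx) as (Hs & Hc & HQ).
  apply Rdiv_lt_0_compat; [exact HQ | apply Rmult_lt_0_compat; lra].
Qed.

Lemma L_weight_pos (k q x : R) : 0 < k -> 0 < q -> 0 < x < PI / 2 -> 0 < L_weight k q x.
Proof.
  intros Hk Hq Hx; destruct (trig_signs x Hx) as (Hs & Hc & HQ).
  apply Rdiv_lt_0_compat; [|exact Hc].
  repeat apply Rmult_lt_0_compat; try lra. apply exp_pos.
Qed.

Lemma sign_mul_pos (s w y : R) : 0 < w ->
  (0 <= s * (w * y) -> 0 <= s * y) /\ (0 < s * y -> 0 < s * (w * y)).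
Proof.
  intros Hw; replace (s * (w * y)) with (w * (s * y)) by ring; split; intros H.
  - apply Rmult_le_reg_l with w; [exact Hw | lra].
  - now apply Rmult_lt_0_compat.
Qed.

Lemma lim0_sign (s : R) (f : R -> R) : lim0 f 0 -> lim0 (fun x => s * f x) 0.
Proof.
  intros Hf; apply (lim0_ext (fun x => s * f x) _ (s * 0)); [reflexivity | ring |].
  now apply lim0_scal.
Qed.

(** The sign climbs from [phi] to [Lfun] to [Gfun], as the latter two vanish at 0. A free [b] allows
    arguments confined to a neighbourhood of 0. *)
Lemma pos_on_Gfun (s k q b : R) : is_sign s -> 0 < k -> 0 < q -> b <= PI / 2 ->
  pos_on b (fun x => s * phi k q x) -> pos_on b (fun x => s * Gfun k q x).
Proof.
  intros Hs Hk Hq Hb Hphi.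
  assert (HL : pos_on b (fun x => s * Lfun k q x)).
  { apply (pos_on_of_derive b _ (fun x => s * (phi_weight x * phi k q x))).
    - intros x Hx; apply is_derive_scal, is_derive_Lfun; lra.
    - apply lim0_sign, lim0_Lfun.
    - intros x Hx; apply sign_mul_pos; [apply phi_weight_pos; lra | now apply Hphi]. }
  apply (pos_on_of_derive b _ (fun x => s * (L_weight k q x * (exp (Lfun k q x) - 1)))).
  - intros x Hx; apply is_derive_scal, is_derive_Gfun; lra.
  - apply lim0_sign, lim0_Gfun.
  - intros x Hx; apply sign_mul_pos; [apply L_weight_pos; lra|].
    apply sign_exp_sub_1; [exact Hs | now apply HL].
Qed.

(** The single sign change climbs from [phi] to [Lfun]; for [Gfun] the stronger strict increase is
    kept, to be set against the limit at [PI / 2]. *)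
Lemma Gfun_increasing_after (s k q : R) : is_sign s -> 0 < k -> 0 < q ->
  single_up (PI / 2) (fun x => s * phi k q x) ->
  forall x y, 0 < x < y -> y < PI / 2 -> 0 <= s * Gfun k q x ->
    s * Gfun k q x < s * Gfun k q y.
Proof.
  intros Hs Hk Hq Hphi.
  assert (HL : single_up (PI / 2) (fun x => s * Lfun k q x)).
  { apply (single_up_of_derive _ _ (fun x => s * (phi_weight x * phi k q x))).
    - intros x Hx; now apply is_derive_scal, is_derive_Lfun.
    - apply lim0_sign, lim0_Lfun.
    - revert Hphi; apply single_up_sign; intros x Hx; apply sign_mul_pos;
        now apply phi_weight_pos. }
  apply (increasing_after _ _ (fun x => s * (L_weight k q x * (exp (Lfun k q x) - 1)))).
  - intros x Hx; now apply is_derive_scal, is_derive_Gfun.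
  - apply lim0_sign, lim0_Gfun.
  - revert HL; apply single_up_sign; intros x Hx H.
    + apply sign_exp_sub_1; [exact Hs|]; revert H; apply sign_mul_pos; now apply L_weight_pos.
    + apply sign_mul_pos; [now apply L_weight_pos|]; now apply sign_exp_sub_1.
Qed.

Lemma Gfun_limit (k q : R) : 0 < k < 3 -> 0 < q ->
  forall eps, 0 < eps -> exists d, 0 < d /\ forall y, PI / 2 - d < y < PI / 2 -> 0 < y ->
    Rabs (Gfun k q y - (1 - k / 3 - Rpower (2 / PI) (k * q))) < eps.
Proof.
  intros Hk Hq eps Heps; generalize PI2_3_2; intros HPI.
  (* [Rpower 0 q] is 1 because [ln 0] is 0, so [Gfun] jumps at [PI / 2]. The power of the cosine is
     therefore split off and only the rest is treated by continuity. *)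
  set (H := fun y => 1 - k / 3 - Rpower (sin y / y) (k * q)).
  assert (HH : continuous H (PI / 2)).
  { apply (ex_derive_continuous H); unfold H, Rpower; auto_derive.
    rewrite sin_PI2; split; [lra|]; split; [|trivial].
    apply Rmult_lt_0_compat; [lra | apply Rinv_0_lt_compat; lra]. }
  assert (HE : H (PI / 2) = 1 - k / 3 - Rpower (2 / PI) (k * q)).
  { unfold H; rewrite sin_PI2; do 2 f_equal; field; lra. }
  destruct (proj1 (filterlim_locally H (H (PI / 2))) HH (mkposreal (eps / 2) ltac:(lra)))
    as [d1 Hd1].
  (* A cosine below [(eps/2)^(1/q)] has [q]-th power below [eps/2]. *)
  assert (Hr : 0 < Rpower (eps / 2) (/ q)) by apply exp_pos.
  destruct (proj1 (filterlim_locally cos (cos (PI / 2))) (continuous_cos (PI / 2))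
              (mkposreal _ Hr)) as [d2 Hd2].
  exists (Rmin d1 d2); split; [apply Rmin_pos; apply cond_pos|].
  intros y Hy Hy0.
  assert (M1 := Rmin_l d1 d2); assert (M2 := Rmin_r d1 d2).
  assert (By : forall d : posreal, PI / 2 - d < y -> ball (PI / 2) d y).
  { intros d Hd; change (Rabs (y - PI / 2) < d); rewrite Rabs_left; lra. }
  specialize (Hd1 y (By d1 ltac:(lra))); specialize (Hd2 y (By d2 ltac:(lra))).
  change (Rabs (H y - H (PI / 2)) < eps / 2) in Hd1.
  change (Rabs (cos y - cos (PI / 2)) < Rpower (eps / 2) (/ q)) in Hd2.
  destruct (trig_signs y ltac:(lra)) as (Hs & Hc & _).
  rewrite cos_PI2, Rminus_0_r, Rabs_pos_eq in Hd2 by lra.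
  assert (Hcq : Rpower (cos y) q < eps / 2).
  { rewrite <- (Rpower_1 (eps / 2)) by lra.
    replace 1 with (/ q * q) by (field; lra).
    rewrite <- Rpower_mult; now apply Rlt_Rpower_l. }
  assert (0 < Rpower (cos y) q) by apply exp_pos.
  rewrite <- HE.
  replace (Gfun k q y - H (PI / 2)) with ((H y - H (PI / 2)) + k / 3 * Rpower (cos y) q)
    by (unfold H, Gfun; ring).
  apply Rle_lt_trans with (1 := Rabs_triang _ _).
  rewrite (Rabs_pos_eq (k / 3 * _)) by (apply Rmult_le_pos; lra).
  assert (k / 3 * Rpower (cos y) q <= 1 * Rpower (cos y) q)
    by (apply Rmult_le_compat_r; lra).
  lra.
Qed.

Lemma Gfun_limit_ge (s k q m c : R) : is_sign s -> 0 < k < 3 -> 0 < q -> 0 <= m < PI / 2 ->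
  (forall y, m < y < PI / 2 -> c <= s * Gfun k q y) ->
  c <= s * (1 - k / 3 - Rpower (2 / PI) (k * q)).
Proof.
  intros Hs Hk Hq Hm H; set (l := 1 - k / 3 - _); apply Rnot_lt_le; intros Hlt.
  destruct (Gfun_limit k q Hk Hq (c - s * l) ltac:(lra)) as (d & Hd & Hy); fold l in Hy.
  (* A point of [(m, PI/2)] within [d] of [PI/2]. *)
  set (y := Rmax ((m + PI / 2) / 2) (PI / 2 - d / 2)).
  assert ((m + PI / 2) / 2 <= y) by apply Rmax_l.
  assert (PI / 2 - d / 2 <= y) by apply Rmax_r.
  assert (y < PI / 2) by (apply Rmax_lub_lt; lra).
  specialize (Hy y ltac:(lra) ltac:(lra)); specialize (H y ltac:(lra)).
  apply Rabs_def2 in Hy; destruct Hs as [-> | ->]; lra.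
Qed.

Lemma Gfun_neg_of_single_up (s k q : R) : is_sign s -> 0 < k < 3 -> 0 < q ->
  Rpower (2 / PI) (k * q) = 1 - k / 3 ->
  single_up (PI / 2) (fun x => s * phi k q x) ->
  forall x, 0 < x < PI / 2 -> s * Gfun k q x < 0.
Proof.
  intros Hs Hk Hq Hend Hphi x Hx; apply Rnot_le_lt; intros Hle.
  assert (Hinc := Gfun_increasing_after s k q Hs ltac:(lra) Hq Hphi).
  (* An intermediate point keeps the inequality strict: the limit is at least the value at [m],
     which is positive, while [Hend] makes it 0. *)
  set (m := (x + PI / 2) / 2).
  assert (Hm : x < m < PI / 2) by (unfold m; lra).
  assert (H1 := Hinc x m ltac:(lra) ltac:(lra) Hle).
  assert (H2 : s * Gfun k q m <= s * (1 - k / 3 - Rpower (2 / PI) (k * q))).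
  { apply (Gfun_limit_ge s k q m); auto; [lra|].
    intros y Hy; left; apply Hinc; lra. }
  rewrite Hend in H2; lra.
Qed.

(** * From the sign of [Gfun] to the comparison of [Mk] with [sin x / x] *)

Lemma Rpower_lt_iff (a b r : R) : 0 < a -> 0 < b -> 0 < r ->
  (Rpower a r < Rpower b r <-> a < b).
Proof.
  intros Ha Hb Hr; split; intros H.
  - apply Rnot_le_lt; intros Hle.
    generalize (Rle_Rpower_l b a r ltac:(lra) ltac:(lra)); lra.
  - now apply Rlt_Rpower_l.
Qed.

Lemma Mk_pos_q (k t q : R) : 0 < q ->
  Mk k t q = Rpower (1 - k / 3 + k / 3 * Rpower t q) (1 / (k * q)).
Proof. intros Hq; unfold Mk; destruct (Req_EM_T q 0); [lra | reflexivity]. Qed.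

(** Gives both sides of the comparison the same positive outer exponent, so that only the bases
    matter. *)
Lemma sinc_root (k q x : R) : 0 < k -> 0 < q -> 0 < x < PI / 2 ->
  sin x / x = Rpower (Rpower (sin x / x) (k * q)) (1 / (k * q)).
Proof.
  intros Hk Hq Hx; destruct (trig_signs x Hx) as (Hs & _ & _).
  rewrite Rpower_mult; replace (k * q * (1 / (k * q))) with 1 by (field; lra).
  rewrite Rpower_1; [reflexivity | apply Rdiv_lt_0_compat; lra].
Qed.

Lemma Mk_base_pos (k t q : R) : 0 < k < 3 -> 0 < 1 - k / 3 + k / 3 * Rpower t q.
Proof.
  intros Hk; assert (0 < k / 3 * Rpower t q) by (apply Rmult_lt_0_compat; [lra | apply exp_pos]).
  lra.
Qed.

Lemma inv_mul_pos (k q : R) : 0 < k -> 0 < q -> 0 < 1 / (k * q).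
Proof. intros Hk Hq; apply Rdiv_lt_0_compat; [lra | now apply Rmult_lt_0_compat]. Qed.

Lemma sinc_lt_Mk_iff (k q x : R) : 0 < k < 3 -> 0 < q -> 0 < x < PI / 2 ->
  (sin x / x < Mk k (cos x) q <-> 0 < Gfun k q x).
Proof.
  intros Hk Hq Hx; rewrite Mk_pos_q, (sinc_root k q x) by lra.
  rewrite Rpower_lt_iff;
    [unfold Gfun; lra | apply exp_pos | now apply Mk_base_pos | apply inv_mul_pos; lra].
Qed.

Lemma Mk_lt_sinc_iff (k q x : R) : 0 < k < 3 -> 0 < q -> 0 < x < PI / 2 ->
  (Mk k (cos x) q < sin x / x <-> Gfun k q x < 0).
Proof.
  intros Hk Hq Hx; rewrite Mk_pos_q, (sinc_root k q x) by lra.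
  rewrite Rpower_lt_iff;
    [unfold Gfun; lra | now apply Mk_base_pos | apply exp_pos | apply inv_mul_pos; lra].
Qed.

(** * Monotonicity of the mean in q *)

(** Weighted arithmetic-geometric mean of [z] and 1. With [m] the right side, [ln y <= y - 1] is
    used at [z/m] and [1/m] with weights [r] and [1 - r]; the bounds add up to 0. *)
Lemma Rpower_bernoulli (z r : R) : 0 < z -> 0 <= r <= 1 -> Rpower z r <= 1 + r * (z - 1).
Proof.
  intros Hz Hr.
  assert (Hln : forall y, 0 < y -> ln y <= y - 1).
  { intros y Hy; generalize (exp_ineq1_le (ln y)); rewrite exp_ln by exact Hy; lra. }
  set (m := 1 + r * (z - 1)).
  assert (Hm : 0 < m).
  { unfold m; destruct (Req_dec r 0) as [->|Hr0]; [lra|].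
    replace (1 + r * (z - 1)) with (r * z + (1 - r)) by ring.
    assert (0 < r * z) by (apply Rmult_lt_0_compat; lra). lra. }
  assert (Hi := Rinv_0_lt_compat m Hm).
  assert (H1 := Hln (z / m) (Rdiv_lt_0_compat _ _ Hz Hm)).
  assert (H2 := Hln (/ m) Hi).
  unfold Rdiv in H1; rewrite ln_mult, ln_Rinv in H1 by assumption.
  rewrite ln_Rinv in H2 by exact Hm.
  assert (H3 : r * ln z <= ln m).
  { assert (E : r * (z * / m - 1) + (1 - r) * (/ m - 1) = 0) by (unfold m; field; fold m; lra).
    assert (r * (ln z + - ln m) <= r * (z * / m - 1)) by (apply Rmult_le_compat_l; lra).
    assert ((1 - r) * (- ln m) <= (1 - r) * (/ m - 1)) by (apply Rmult_le_compat_l; lra).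
    lra. }
  rewrite <- (exp_ln m) by exact Hm; unfold Rpower.
  destruct H3 as [H3 | ->]; [left; now apply exp_increasing | lra].
Qed.

(** Concavity of the power [r]: after scaling by the mean [m], it is the weighted sum of
    [Rpower_bernoulli] at [1/m] and [u/m], whose linear terms cancel. *)
Lemma weighted_Rpower_le (w u r : R) : 0 < w < 1 -> 0 < u -> 0 <= r <= 1 ->
  w + (1 - w) * Rpower u r <= Rpower (w + (1 - w) * u) r.
Proof.
  intros Hw Hu Hr; set (m := w + (1 - w) * u).
  assert (Hm : 0 < m)
    by (unfold m; assert (0 < (1 - w) * u) by (apply Rmult_lt_0_compat; lra); lra).
  assert (Hi := Rinv_0_lt_compat m Hm).
  assert (Hum : 0 < u * / m) by now apply Rmult_lt_0_compat.
  assert (H1 := Rpower_bernoulli _ _ Hi Hr); assert (H2 := Rpower_bernoulli _ _ Hum Hr).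
  assert (E1 : 1 = Rpower m r * Rpower (/ m) r).
  { rewrite Rpower_mult_distr, Rinv_r by (auto; lra).
    unfold Rpower; now rewrite ln_1, Rmult_0_r, exp_0. }
  assert (E2 : Rpower u r = Rpower m r * Rpower (u * / m) r).
  { rewrite Rpower_mult_distr by auto; f_equal; field; lra. }
  rewrite E2; replace w with (w * 1) at 1 by ring; rewrite E1 at 1.
  replace (w * (Rpower m r * Rpower (/ m) r) + (1 - w) * (Rpower m r * Rpower (u * / m) r))
    with (Rpower m r * (w * Rpower (/ m) r + (1 - w) * Rpower (u * / m) r)) by ring.
  rewrite <- (Rmult_1_r (Rpower m r)) at 2.
  apply Rmult_le_compat_l; [left; apply exp_pos|].
  apply Rle_trans with (w * (1 + r * (/ m - 1)) + (1 - w) * (1 + r * (u * / m - 1))).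
  - apply Rplus_le_compat; apply Rmult_le_compat_l; lra.
  - right; unfold m; field; fold m; lra.
Qed.

(** With [l = ln t] and [q <> 0], this is [k q] times the logarithm of [Mk k t q]; it is convex in
    [q] and vanishes at 0. *)
Definition ln_mean (k l q : R) : R := ln (1 - k / 3 + k / 3 * exp (q * l)).

Lemma ln_mean_mul (k l q r : R) : 0 < k < 3 -> 0 <= r <= 1 ->
  ln_mean k l (r * q) <= r * ln_mean k l q.
Proof.
  intros Hk Hr; unfold ln_mean.
  assert (H := weighted_Rpower_le (1 - k / 3) (exp (q * l)) r ltac:(lra) (exp_pos _) Hr).
  replace (1 - (1 - k / 3)) with (k / 3) in H by ring.
  unfold Rpower in H at 1; rewrite ln_exp in H.
  replace (r * q * l) with (r * (q * l)) by ring.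
  rewrite <- (ln_exp (r * ln _)).
  assert (0 < k / 3 * exp (r * (q * l))) by (apply Rmult_lt_0_compat; [lra | apply exp_pos]).
  apply ln_le; [lra | exact H].
Qed.

(** The tangent at [q = 0], for comparison with the exponent 0. *)
Lemma ln_mean_tangent (k l q : R) : 0 < k < 3 -> k / 3 * (q * l) <= ln_mean k l q.
Proof.
  intros Hk; unfold ln_mean.
  assert (H := Rpower_bernoulli (exp (q * l)) (k / 3) (exp_pos _) ltac:(lra)).
  unfold Rpower in H; rewrite ln_exp in H.
  rewrite <- (ln_exp (k / 3 * (q * l))); apply ln_le; [apply exp_pos | lra].
Qed.

Lemma Mk_ln_mean (k t q : R) :
  Mk k t q = exp (if Req_EM_T q 0 then ln t / 3 else ln_mean k (ln t) q / (k * q)).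
Proof.
  unfold Mk, ln_mean, Rpower; destruct (Req_EM_T q 0); f_equal; [field|].
  unfold Rdiv; ring.
Qed.

(** Up to the factor [k], the logarithm of the mean is the slope of the chord of [ln_mean] from 0 to
    [q]. Exponents of equal sign are compared by [ln_mean_mul], all others through 0. *)
Lemma Mk_le (k t q q' : R) : 0 < k < 3 -> q <= q' -> Mk k t q <= Mk k t q'.
Proof.
  intros Hk Hqq; rewrite !Mk_ln_mean.
  set (l := ln t); set (g := fun q => if Req_EM_T q 0 then l / 3 else ln_mean k l q / (k * q)).
  change (exp (g q) <= exp (g q')).
  assert (Hg : forall r, r <> 0 -> g r * (k * r) = ln_mean k l r).
  { intros r Hr; unfold g; destruct (Req_EM_T r 0); [contradiction | field; lra]. }
  assert (Hg0 : g 0 = l / 3) by (unfold g; destruct (Req_EM_T 0 0); [reflexivity | lra]).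
  assert (Hpos : forall r, 0 < r -> g 0 <= g r).
  { intros r Hr; assert (H := ln_mean_tangent k l r Hk); rewrite <- Hg in H by lra.
    rewrite Hg0; apply Rmult_le_reg_r with (k * r); [apply Rmult_lt_0_compat; lra | lra]. }
  assert (Hneg : forall r, r < 0 -> g r <= g 0).
  { intros r Hr; assert (H := ln_mean_tangent k l r Hk); rewrite <- Hg in H by lra.
    rewrite Hg0; apply Rmult_le_reg_r with (k * - r); [apply Rmult_lt_0_compat; lra | lra]. }
  assert (Hle : g q <= g q').
  { destruct (Req_dec q q') as [->|Hne]; [lra|].
    destruct (Rtotal_order q 0) as [Hq | [-> | Hq]]; [| apply Hpos; lra |].
    - destruct (Rtotal_order q' 0) as [Hq' | [-> | Hq']]; [| now apply Hneg |
        apply Rle_trans with (g 0); auto].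
      assert (Hr : 0 <= q' / q <= 1).
      { replace (q' / q) with (- q' / - q) by (field; lra).
        split; [apply Rdiv_le_0_compat; lra | apply Rle_div_l; lra]. }
      assert (H := ln_mean_mul k l q (q' / q) Hk Hr).
      replace (q' / q * q) with q' in H by (field; lra).
      rewrite <- !Hg in H by lra.
      apply Rmult_le_reg_r with (k * - q'); [apply Rmult_lt_0_compat; lra|].
      replace (q' / q * (g q * (k * q))) with (g q * (k * q')) in H by (field; lra). lra.
    - assert (Hr : 0 <= q / q' <= 1)
        by (split; [apply Rdiv_le_0_compat; lra | apply Rle_div_l; lra]).
      assert (H := ln_mean_mul k l q' (q / q') Hk Hr).
      replace (q / q' * q') with q in H by (field; lra).
      rewrite <- !Hg in H by lra.
      apply Rmult_le_reg_r with (k * q); [apply Rmult_lt_0_compat; lra|].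
      replace (q / q' * (g q' * (k * q'))) with (g q' * (k * q)) in H by (field; lra). lra. }
  destruct Hle as [Hle | ->]; [left; now apply exp_increasing | lra].
Qed.

(** * The critical exponents *)

Lemma two_div_PI_pos : 0 < 2 / PI.
Proof. generalize PI_RGT_0; intros H; apply Rdiv_lt_0_compat; lra. Qed.

(** [(PI/2)^3 > (3/2)^3 = 27/8 > 3 >= e]. *)
Lemma ln_two_div_PI_lt : ln (2 / PI) < - (1 / 3).
Proof.
  generalize PI2_3_2 PI_RGT_0; intros H HPI.
  replace (2 / PI) with (/ (PI / 2)) by (field; lra).
  rewrite ln_Rinv by lra.
  assert (H1 : ln (3 / 2) < ln (PI / 2)) by (apply ln_increasing; lra).
  assert (H2 : 1 < ln ((3 / 2) ^ 3)).
  { rewrite <- (ln_exp 1); apply ln_increasing; [apply exp_pos | generalize exp_le_3; lra]. }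
  rewrite ln_pow in H2 by lra; simpl in H2; lra.
Qed.

Lemma pfun_eq (p v : R) : v <> 0 -> pfun p = v -> p = 3 * v * (1 - Rpower (2 / PI) p).
Proof.
  intros Hv H; unfold pfun in H.
  (* A zero denominator would make the quotient 0, as [/ 0 = 0], against [v <> 0]. *)
  destruct (Req_dec (1 - Rpower (2 / PI) p) 0) as [E|E].
  - rewrite E, Rmult_0_r in H; unfold Rdiv in H; rewrite Rinv_0 in H; lra.
  - rewrite <- H; field; lra.
Qed.

(** For [p < 0] and [l = ln (2/PI)], [exp (p l) >= 1 + p l] would give [p (3 l + 1) <= 0], although
    both factors are negative. *)
Lemma pfun_eq_1_pos (p : R) : pfun p = 1 -> 0 < p.
Proof.
  intros H; assert (E := pfun_eq p 1 ltac:(lra) H); apply Rnot_le_lt; intros Hp.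
  assert (p <> 0) by (intros ->; unfold pfun, Rdiv in H; lra).
  assert (H1 := exp_ineq1_le (p * ln (2 / PI))); fold (Rpower (2 / PI) p) in H1.
  assert (0 < p * (3 * ln (2 / PI) + 1))
    by (apply Rmult_neg_neg; [lra | generalize ln_two_div_PI_lt; lra]).
  lra.
Qed.

(** Convexity of the exponential, from Bernoulli with exponent [x / y]. *)
Lemma Rpower_chord (a x y : R) : 0 < a -> 0 < y -> 0 <= x <= y ->
  Rpower a x <= 1 + x / y * (Rpower a y - 1).
Proof.
  intros Ha Hy Hx.
  replace x with (y * (x / y)) at 1 by (field; lra).
  rewrite <- Rpower_mult; apply Rpower_bernoulli; [apply exp_pos|].
  split; [apply Rdiv_le_0_compat; lra | apply Rle_div_l; lra].
Qed.

(* The exponent at which [Gfun k q] vanishes at [PI / 2]. *)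
Definition qend (k : R) : R := ln (1 - k / 3) / (k * ln (2 / PI)).

Lemma qend_pos (k : R) : 0 < k < 3 -> 0 < qend k.
Proof.
  intros Hk; unfold qend; generalize ln_two_div_PI_lt; intros Hl.
  assert (ln (1 - k / 3) < 0) by (rewrite <- ln_1; apply ln_increasing; lra).
  replace (_ / _) with (- ln (1 - k / 3) / (k * - ln (2 / PI))) by (field; lra).
  apply Rdiv_lt_0_compat; [|apply Rmult_lt_0_compat]; lra.
Qed.

Lemma Rpower_qend (k : R) : 0 < k < 3 -> Rpower (2 / PI) (k * qend k) = 1 - k / 3.
Proof.
  intros Hk; generalize ln_two_div_PI_lt; intros Hl; unfold Rpower, qend.
  replace (k * _ * _) with (ln (1 - k / 3)) by (field; lra).
  apply exp_ln; lra.
Qed.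

Lemma Rpower_two_div_PI_lt (k q q' : R) : 0 < k -> q < q' ->
  Rpower (2 / PI) (k * q') < Rpower (2 / PI) (k * q).
Proof.
  intros Hk Hq; generalize ln_two_div_PI_lt; intros Hl; apply exp_increasing.
  assert (0 < k * (q' - q) * - ln (2 / PI)) by (repeat apply Rmult_lt_0_compat; lra).
  lra.
Qed.

Lemma le_qend (k q : R) : 0 < k < 3 -> 1 - k / 3 <= Rpower (2 / PI) (k * q) -> q <= qend k.
Proof.
  intros Hk H; apply Rnot_lt_le; intros Hlt.
  generalize (Rpower_two_div_PI_lt k _ _ ltac:(lra) Hlt); rewrite Rpower_qend by exact Hk; lra.
Qed.

Lemma qend_le (k q : R) : 0 < k < 3 -> Rpower (2 / PI) (k * q) <= 1 - k / 3 -> qend k <= q.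
Proof.
  intros Hk H; apply Rnot_lt_le; intros Hlt.
  generalize (Rpower_two_div_PI_lt k _ _ ltac:(lra) Hlt); rewrite Rpower_qend by exact Hk; lra.
Qed.

(** The convex function [(2/PI)^p] meets the line [1 - p/3] at 0 and at [p0], so it lies above that
    line at [k > p0]. *)
Lemma qend_ge_1 (p0 k : R) : pfun p0 = 1 -> p0 < k < 3 -> 1 <= qend k.
Proof.
  intros Hp Hk; assert (Hp0 := pfun_eq_1_pos p0 Hp).
  assert (E := pfun_eq p0 1 ltac:(lra) Hp).
  apply le_qend; [lra|]; rewrite Rmult_1_r.
  assert (H := Rpower_chord (2 / PI) p0 k two_div_PI_pos ltac:(lra) ltac:(lra)).
  assert (H' : k * (1 - p0 / 3) <= k * (1 + p0 / k * (Rpower (2 / PI) k - 1)))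
    by (apply Rmult_le_compat_l; lra).
  replace (k * (1 + p0 / k * (Rpower (2 / PI) k - 1)))
    with (k + p0 * (Rpower (2 / PI) k - 1)) in H' by (field; lra).
  apply Rmult_le_reg_l with p0; lra.
Qed.

(** [(2/PI)^p] meets the line [1 - (35/102) p] at 0 and at [p0s], so it lies below it at [k]. A
    second chord, over [[0, k]] at [34 k / 35], turns the slope [35/102] into [1/3]; positivity of
    the power then gives [k < 3]. *)
Lemma qend_le_34_35 (p0s k : R) : pfun p0s = 34 / 35 -> 0 < k < p0s ->
  k < 3 /\ qend k <= 34 / 35.
Proof.
  intros Hp Hk; assert (E := pfun_eq p0s (34 / 35) ltac:(lra) Hp).
  assert (Ha := two_div_PI_pos).
  assert (H1 := Rpower_chord (2 / PI) k p0s Ha ltac:(lra) ltac:(lra)).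
  replace (Rpower (2 / PI) p0s - 1) with (- (35 / 102) * p0s) in H1 by lra.
  replace (k / p0s * (- (35 / 102) * p0s)) with (- (35 / 102) * k) in H1 by (field; lra).
  assert (H2 := Rpower_chord (2 / PI) (k * (34 / 35)) k Ha ltac:(lra) ltac:(lra)).
  replace (k * (34 / 35) / k) with (34 / 35) in H2 by (field; lra).
  assert (H3 : 0 < Rpower (2 / PI) (k * (34 / 35))) by apply exp_pos.
  split; [lra | apply qend_le; lra].
Qed.

(* The exponent at which [phi k q] vanishes at [0]. *)
Definition qorig (k : R) : R := 8 / (5 * (3 - k)).

Lemma qorig_eq (k : R) : k < 3 -> (3 - k) * qorig k = 8 / 5.
Proof. intros Hk; unfold qorig; field; lra. Qed.

(** For [q <= 34/35], [D' + (q - 1) T' <= D' - T'/35 < 0]. *)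
Lemma phi_monotone (s q x : R) : s = 1 /\ 1 <= q \/ s = -1 /\ q <= 34 / 35 ->
  0 < x < PI / 2 -> 0 < s * (Dfun' x + (q - 1) * Tfun' x).
Proof.
  intros Hs Hx; generalize (Dfun'_pos x Hx) (Dfun'_lt x Hx) (Tfun'_pos x Hx); intros HD HDT HT.
  destruct Hs as [[-> Hq] | [-> Hq]].
  - assert (0 <= (q - 1) * Tfun' x) by (apply Rmult_le_pos; lra). lra.
  - assert (0 <= (34 / 35 - q) * Tfun' x) by (apply Rmult_le_pos; lra). lra.
Qed.

Lemma Gfun_sign_orig (s k : R) : 0 < k < 3 ->
  s = 1 /\ 1 <= qorig k \/ s = -1 /\ qorig k <= 34 / 35 ->
  forall x, 0 < x < PI / 2 -> 0 < s * Gfun k (qorig k) x.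
Proof.
  intros Hk Hs; assert (E := qorig_eq k ltac:(lra)).
  assert (Hq : 0 < qorig k) by (apply Rmult_lt_reg_l with (3 - k); lra).
  apply (pos_on_Gfun s k (qorig k) (PI / 2)); [unfold is_sign; tauto | lra | exact Hq | lra |].
  apply (pos_on_of_derive _ _ (fun x => s * (Dfun' x + (qorig k - 1) * Tfun' x))).
  - intros x Hx; now apply is_derive_scal, is_derive_phi.
  - apply lim0_sign; generalize (lim0_phi k (qorig k)); now rewrite E, Rminus_diag.
  - intros x Hx; now apply phi_monotone.
Qed.

Lemma Gfun_sign_end (s k : R) : 0 < k < 3 ->
  s = 1 /\ 1 <= qend k \/ s = -1 /\ qend k <= 34 / 35 ->
  forall x, 0 < x < PI / 2 -> s * Gfun k (qend k) x < 0.
Proof.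
  intros Hk Hs; apply Gfun_neg_of_single_up;
    [unfold is_sign; tauto | exact Hk | now apply qend_pos | now apply Rpower_qend |].
  apply (single_up_of_derive_pos _ _ (fun x => s * (Dfun' x + (qend k - 1) * Tfun' x))).
  - intros x Hx; now apply is_derive_scal, is_derive_phi.
  - intros x Hx; now apply phi_monotone.
Qed.

(** Supplies the counterexamples that make [qorig k] sharp: near 0, [phi] has the sign of its limit
    [(3 - k) (q - qorig k)]. *)
Lemma Gfun_sign_near_0 (s k q : R) : is_sign s -> 0 < k < 3 -> 0 < q ->
  0 < s * (q - qorig k) -> exists x, 0 < x < PI / 2 /\ 0 < s * Gfun k q x.
Proof.
  intros Hs Hk Hq Hsq; generalize PI2_3_2; intros HPI.
  assert (E := qorig_eq k ltac:(lra)).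
  assert (Hlim : lim0 (fun x => s * phi k q x) (s * ((3 - k) * q - 8 / 5)))
    by apply lim0_scal, lim0_phi.
  destruct (lim0_pos _ _ Hlim) as (d & Hd & Hphi).
  { rewrite <- E; replace (s * _) with ((3 - k) * (s * (q - qorig k))) by ring.
    apply Rmult_lt_0_compat; lra. }
  set (b := Rmin d (PI / 2)).
  assert (Hbd : b <= d) by apply Rmin_l; assert (HbP : b <= PI / 2) by apply Rmin_r.
  assert (Hb : 0 < b) by (apply Rmin_pos; lra).
  exists (b / 2); split; [lra|].
  apply (pos_on_Gfun s k q b); try assumption; try lra.
  intros x Hx; apply Hphi; lra.
Qed.

(** * The four equivalences *)

Theorem theorem6 (p0 p0s : R)
  (Hp0 : pfun p0 = 1) (Hp0s : pfun p0s = 34/35) :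
  (forall k q : R, 7/5 <= k < 3 ->
     ((forall x : R, 0 < x < PI/2 -> sin x / x < Mk k (cos x) q)
      <-> q >= 8 / (5 * (3 - k)))) /\
  (forall k q : R, p0 < k < 3 ->
     ((forall x : R, 0 < x < PI/2 -> Mk k (cos x) q < sin x / x)
      <-> q <= ln (1 - k/3) / (k * ln (2/PI)))) /\
  (forall k q : R, 0 < k <= 23/17 ->
     ((forall x : R, 0 < x < PI/2 -> Mk k (cos x) q < sin x / x)
      <-> q <= 8 / (5 * (3 - k)))) /\
  (forall k q : R, 0 < k < p0s ->
     ((forall x : R, 0 < x < PI/2 -> sin x / x < Mk k (cos x) q)
      <-> q >= ln (1 - k/3) / (k * ln (2/PI)))).
Proof.
  generalize PI2_3_2; intros HPI.
  assert (Hqo : forall k, 0 < k < 3 -> 0 < qorig k).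
  { intros k Hk; apply Rmult_lt_reg_l with (3 - k); [lra|].
    rewrite qorig_eq by lra; lra. }
  split; [|split; [|split]]; intros k q Hkq;
    try fold (qorig k); try fold (qend k); split; intros H.
  - apply Rnot_lt_ge; intros Hlt.
    assert (Hk : 0 < k < 3) by lra; specialize (Hqo k Hk).
    (* The criteria on [Gfun] need a positive exponent, so [q] is raised to some [q'] in
       [(0, qorig k)]; the assumed inequality persists by [Mk_le]. *)
    set (q' := Rmax q (qorig k / 2)).
    assert (q <= q') by apply Rmax_l; assert (qorig k / 2 <= q') by apply Rmax_r.
    assert (q' < qorig k) by (apply Rmax_lub_lt; lra).
    destruct (Gfun_sign_near_0 (-1) k q') as (x & Hx & HG);
      [now right | lra | lra | lra |].
    specialize (H x Hx); assert (HM := Mk_le k (cos x) q q' Hk ltac:(lra)).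
    assert (0 < Gfun k q' x) by (apply sinc_lt_Mk_iff; lra). lra.
  - intros x Hx; assert (Hk : 0 < k < 3) by lra; specialize (Hqo k Hk).
    apply Rlt_le_trans with (Mk k (cos x) (qorig k)); [|apply Mk_le; lra].
    apply sinc_lt_Mk_iff; auto; rewrite <- (Rmult_1_l (Gfun _ _ _)).
    apply Gfun_sign_orig; auto; left; split; [reflexivity|].
    (* [k >= 7/5] means [3 - k <= 8/5], that is [qorig k >= 1]. *)
    apply Rmult_le_reg_l with (3 - k); [|rewrite qorig_eq]; lra.
  - assert (Hk : 0 < k < 3) by (generalize (pfun_eq_1_pos p0 Hp0); lra).
    (* For [q <= 0] the claim is [qend_pos]; for [q > 0] the sign of [Gfun] passes to its limit at
       [PI / 2]. *)
    destruct (Rle_lt_dec q 0) as [Hq|Hq]; [generalize (qend_pos k Hk); lra|].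
    apply le_qend; [exact Hk|].
    assert (HG := Gfun_limit_ge (-1) k q 0 0 ltac:(now right) Hk Hq ltac:(lra)).
    assert (0 <= -1 * (1 - k / 3 - Rpower (2 / PI) (k * q))); [|lra].
    apply HG; intros y Hy; assert (Gfun k q y < 0) by (apply Mk_lt_sinc_iff; auto). lra.
  - intros x Hx; assert (Hk : 0 < k < 3) by (generalize (pfun_eq_1_pos p0 Hp0); lra).
    apply Rle_lt_trans with (Mk k (cos x) (qend k)); [apply Mk_le; lra|].
    apply Mk_lt_sinc_iff; auto; [now apply qend_pos|]; rewrite <- (Rmult_1_l (Gfun _ _ _)).
    apply Gfun_sign_end; auto; left; split; [reflexivity|]; now apply (qend_ge_1 p0).
  - apply Rnot_lt_le; intros Hlt.
    assert (Hk : 0 < k < 3) by lra; specialize (Hqo k Hk).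
    destruct (Gfun_sign_near_0 1 k q) as (x & Hx & HG); [now left | lra | lra | lra |].
    assert (Gfun k q x < 0) by (apply Mk_lt_sinc_iff; auto; lra). lra.
  - intros x Hx; assert (Hk : 0 < k < 3) by lra; specialize (Hqo k Hk).
    apply Rle_lt_trans with (Mk k (cos x) (qorig k)); [apply Mk_le; lra|].
    apply Mk_lt_sinc_iff; auto.
    assert (0 < -1 * Gfun k (qorig k) x); [|lra].
    apply Gfun_sign_orig; auto; right; split; [reflexivity|].
    (* [k <= 23/17] gives [3 - k >= 28/17], and [(34/35) (28/17) = 8/5], so [qorig k <= 34/35]. *)
    apply Rmult_le_reg_l with (3 - k); [|rewrite qorig_eq]; lra.
  - destruct (qend_le_34_35 p0s k Hp0s ltac:(lra)) as [Hk3 Hq35].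
    assert (Hk : 0 < k < 3) by lra; assert (Hqe := qend_pos k Hk).
    apply Rnot_lt_ge; intros Hlt.
    (* Again a positive exponent below the critical one; the limit at [PI / 2] then forces
       [qend k <= q'], a contradiction. *)
    set (q' := Rmax q (qend k / 2)).
    assert (q <= q') by apply Rmax_l; assert (qend k / 2 <= q') by apply Rmax_r.
    assert (q' < qend k) by (apply Rmax_lub_lt; lra).
    assert (Hle : qend k <= q'); [|lra].
    assert (HG := Gfun_limit_ge 1 k q' 0 0 ltac:(now left) Hk ltac:(lra) ltac:(lra)).
    assert (0 <= 1 * (1 - k / 3 - Rpower (2 / PI) (k * q'))); [|apply qend_le; lra].
    apply HG; intros y Hy; assert (0 < Gfun k q' y); [|lra].
    apply sinc_lt_Mk_iff; [exact Hk | lra | exact Hy |].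
    apply Rlt_le_trans with (Mk k (cos y) q); [now apply H | now apply Mk_le].
  - intros x Hx; destruct (qend_le_34_35 p0s k Hp0s ltac:(lra)) as [Hk3 Hq35].
    assert (Hk : 0 < k < 3) by lra.
    apply Rlt_le_trans with (Mk k (cos x) (qend k)); [|apply Mk_le; lra].
    apply sinc_lt_Mk_iff; auto; [now apply qend_pos|].
    assert (-1 * Gfun k (qend k) x < 0); [|lra].
    apply Gfun_sign_end; auto.
Qed.
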